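(* Let $K \subseteq \mathbb{R}^d$ be a convex set with $K = -K$ such that the only point of $\mathbb{Z}^d$ in the relative interior of $K$ is the origin. Let $K_{\mathbb{Z}} = K \cap \mathbb{Z}^d$ and $\mathscr{K} = \{K + 2\alpha : \alpha \in K_{\mathbb{Z}}\}$. Then the union of the elements of $\mathscr{K}$ is contained in $3K$, and the relative interiors of the sets $K + 2\alpha$, $\alpha \in K_{\mathbb{Z}}$, are pairwise disjoint (for distinct $\alpha$). *)

(* Defs.v *)
From mathcomp Require Import all_boot all_order all_algebra.
From mathcomp Require Import all_classical all_reals all_analysis.

Set Implicit Arguments.
Unset Strict Implicit.
Unset Printing Implicit Defensive.

Import Order.TTheory GRing.Theory Num.Theory numFieldNormedType.Exports.

Local Open Scope classical_set_scope.
Local Open Scope ring_scope.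

Definition affine_hull (R : realType) (d : nat) (A : set 'rV[R]_d) :
    set 'rV[R]_d :=
  [set x | exists (n : nat) (c : 'I_n -> R) (v : 'I_n -> 'rV[R]_d),
    [/\ forall i, A (v i), \sum_i c i = 1 & x = \sum_i c i *: v i]].

(* Interior of A for the subspace topology of its affine hull; the norm on
   'rV[R]_d is the sup norm, which induces the Euclidean topology. *)
Definition relint (R : realType) (d : nat) (A : set 'rV[R]_d) :
    set 'rV[R]_d :=
  [set x | affine_hull A x /\ within (affine_hull A) (nbhs x) A].

Definition int_lattice (R : realType) (d : nat) : set 'rV[R]_d :=
  [set x | forall i, x ord0 i \is a Num.int].
Arguments int_lattice R d : clear implicits.

Definition translate (R : realType) (d : nat) (A : set 'rV[R]_d)
    (v : 'rV[R]_d) : set 'rV[R]_d :=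
  [set x + v | x in A].

Definition dilate (R : realType) (d : nat) (c : R) (A : set 'rV[R]_d) :
    set 'rV[R]_d :=
  [set c *: x | x in A].

(* Main.v *)
(* A point x of relint (K + 2 alpha) and relint (K + 2 beta) gives the points
   x - 2 alpha and, by symmetry of K, 2 beta - x of relint K.  Their midpoint
   beta - alpha is a lattice point of relint K, hence 0.  The inclusion in 3K
   is convexity: x + 2 alpha = 3 (x / 3 + 2 alpha / 3). *)
Require Import Defs.
From mathcomp Require Import all_boot all_order all_algebra.
From mathcomp Require Import all_classical all_reals all_analysis.
From mathcomp Require Import ring.

Set Implicit Arguments.
Unset Strict Implicit.
Unset Printing Implicit Defensive.

Import Order.TTheory GRing.Theory Num.Theory numFieldNormedType.Exports.

Local Open Scope classical_set_scope.
Local Open Scope ring_scope.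

(** Concatenate the two families, multiplying the coefficients of the first by [s] and those of the
    second by [t]; their total is [s + t = 1]. No sign is imposed on [s] and [t], so extrapolation
    is allowed as well. *)
Lemma affine_hull_comb (R : realType) (d : nat) (A : set 'rV[R]_d) (s t : R)
    (x y : 'rV[R]_d) :
  s + t = 1 -> affine_hull A x -> affine_hull A y ->
  affine_hull A (s *: x + t *: y).
Proof.
move=> st [m [b [u [Au b1 ->]]]] [n [c [v [Av c1 ->]]]].
exists (m + n)%N.
exists (fun i => match fintype.split i with
                 | inl j => s * b j | inr k => t * c k end).
exists (fun i => match fintype.split i with
                 | inl j => u j | inr k => v k end).
have splitl j : fintype.split (lshift n j) = inl j by apply: (unsplitK (inl j)).
have splitr k : fintype.split (rshift m k) = inr k by apply: (unsplitK (inr k)).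
split.
- by move=> i; case: (fintype.split i).
- rewrite big_split_ord/=.
  under eq_bigr do rewrite splitl.
  under [X in _ + X]eq_bigr do rewrite splitr.
  by rewrite -!mulr_sumr b1 c1 !mulr1.
- rewrite big_split_ord/= !scaler_sumr; congr (_ + _); apply: eq_bigr => i _.
  + by rewrite splitl scalerA.
  + by rewrite splitr scalerA.
Qed.

Lemma affine_hull_parallelogram (R : realType) (d : nat) (A : set 'rV[R]_d)
    (x y z : 'rV[R]_d) :
  affine_hull A x -> affine_hull A y -> affine_hull A z ->
  affine_hull A (x + y - z).
Proof.
move=> Ax Ay Az.
(* Two nested binary combinations: the midpoint of [x] and [y], then the reflection of [z] through
   it, with weights 2 and -1. *)
have -> : x + y - z = 2 *: (2^-1 *: x + 2^-1 *: y) + (-1) *: z.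
  by rewrite scalerDr !scalerA divff ?pnatr_eq0// !scale1r scaleN1r.
apply: affine_hull_comb => //; first by ring.
by apply: affine_hull_comb => //; field.
Qed.

Lemma affine_hull_opp (R : realType) (d : nat) (A : set 'rV[R]_d)
    (x : 'rV[R]_d) :
  affine_hull A x -> affine_hull [set - y | y in A] (- x).
Proof.
move=> [n [c [v [Av c1 ->]]]]; exists n, c, (fun i => - v i); split=> //.
- by move=> i; exists (v i).
- by rewrite -sumrN; apply: eq_bigr => i _; rewrite scalerN.
Qed.

Lemma affine_hull_translate (R : realType) (d : nat) (A : set 'rV[R]_d)
    (v x : 'rV[R]_d) :
  affine_hull A x -> affine_hull (translate A v) (x + v).
Proof.
move=> [n [c [w [Aw c1 ->]]]]; exists n, c, (fun i => w i + v); split=> //.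
- by move=> i; exists (w i).
- under [RHS]eq_bigr do rewrite scalerDr.
  by rewrite big_split/= -scaler_suml c1 scale1r.
Qed.

Lemma translateK (R : realType) (d : nat) (A : set 'rV[R]_d) (v : 'rV[R]_d) :
  translate (translate A v) (- v) = A.
Proof.
apply/seteqP; split=> [_ [_ [x Ax <-] <-]|x Ax]; first by rewrite addrK.
by exists (x + v); [exists x | rewrite addrK].
Qed.

(** Neighbourhoods are expressed by displacements [u] from the point, so that one [u] can be carried
    along under translation, negation and midpoints. *)
Lemma relintP (R : realType) (d : nat) (A : set 'rV[R]_d) (x : 'rV[R]_d) :
  relint A x <-> affine_hull A x /\
    exists2 e : R, 0 < e &
      forall u, `|u| < e -> affine_hull A (x + u) -> A (x + u).
Proof.
split=> -[hx near_x]; split=> //.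
- have [e e0 sub] := (nbhs_ballP _ _).1 near_x; exists e => // u ue hu.
  by apply: sub => //; rewrite -ball_normE /= opprD addNKr normrN.
- case: near_x => e e0 sub; apply/nbhs_ballP; exists e => // y.
  rewrite -ball_normE /= => xy hy.
  by rewrite -(subrKC x y); apply: sub; rewrite ?subrKC // distrC.
Qed.

Lemma relint_opp (R : realType) (d : nat) (A : set 'rV[R]_d) (x : 'rV[R]_d) :
  relint A x -> relint [set - y | y in A] (- x).
Proof.
move=> /relintP[hx [e e0 sub]]; apply/relintP; split.
  exact: affine_hull_opp.
exists e => // u ue /affine_hull_opp hu; exists (x - u).
  apply: sub; rewrite ?normrN //.
  (* Here [hu] concerns the hull of the twice negated set, which is [A] itself. *)
  move: hu; rewrite image_comp opprD !opprK.
  by under eq_imagel do rewrite /= opprK; rewrite image_id.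
by rewrite opprB addrC.
Qed.

Lemma relint_translate (R : realType) (d : nat) (A : set 'rV[R]_d)
    (v x : 'rV[R]_d) :
  relint (translate A v) x -> relint A (x - v).
Proof.
move=> /relintP[hx [e e0 sub]]; apply/relintP; split.
  by rewrite -(translateK A v); apply: affine_hull_translate.
exists e => // u ue /(@affine_hull_translate _ _ _ v); rewrite addrAC subrK.
move=> /(sub _ ue)[y Ay yxu]; suff -> : x - v + u = y by [].
by rewrite addrAC -yxu addrK.
Qed.

Lemma convex_set_comb (R : realType) (d : nat) (A : set 'rV[R]_d) (s t : R)
    (x y : 'rV[R]_d) :
  convex_set A -> 0 <= s -> 0 <= t -> s + t = 1 -> A x -> A y ->
  A (s *: x + t *: y).
Proof.
move=> cA s0 t0 st Ax Ay.
have s1 : s <= 1 by rewrite -st lerDl.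
have /set_mem := cA x y (Itv01 s0 s1) (mem_set Ax) (mem_set Ay).
by have -> : t = 1 - s by rewrite -st addrC addKr.
Qed.

(** A displacement [u] shorter than both radii and keeping the midpoint in the hull keeps [x] and
    [y] there too. Hence [x + u] and [y + u] lie in [A], and so does their midpoint, which is the
    original one displaced by [u]. *)
Lemma relint_midpoint (R : realType) (d : nat) (A : set 'rV[R]_d)
    (x y : 'rV[R]_d) :
  convex_set A -> relint A x -> relint A y -> relint A (2^-1 *: (x + y)).
Proof.
move=> cA /relintP[hx [e e0 subx]] /relintP[hy [f f0 suby]]; apply/relintP.
have hm : affine_hull A (2^-1 *: (x + y)).
  by rewrite scalerDr; apply: affine_hull_comb => //; field.
split=> //; exists (Num.min e f); first by rewrite lt_min e0 f0.
move=> u; rewrite lt_min => /andP[ue uf] hu.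
(* With [m] the midpoint, [u] is the difference of the hull points [m + u] and [m], hence a
   direction of the hull: [z + u = z + (m + u) - m]. *)
have hD z : affine_hull A z -> affine_hull A (z + u).
  move=> hz; have := affine_hull_parallelogram hz hu hm.
  by rewrite (addrC _ u) addrA addrK.
have -> : 2^-1 *: (x + y) + u = 2^-1 *: ((x + u) + (y + u)).
  rewrite addrACA [RHS]scalerDr; congr (_ + _).
  rewrite -mulr2n -(scaler_nat 2 u) scalerA.
  by rewrite mulVf ?pnatr_eq0// scale1r.
rewrite scalerDr; apply: convex_set_comb => //; first by field.
- by apply: subx => //; apply: hD.
- by apply: suby => //; apply: hD.
Qed.

Theorem theorem3p1 (R : realType) (d : nat) (K : set 'rV[R]_d)
    (K_convex : convex_set K)
    (K_sym : K = [set - x | x in K])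
    (K_lattice : relint K `&` int_lattice R d = [set 0]) :
  let KZ := K `&` int_lattice R d in
  let calK := [set translate K (2 *: alpha) | alpha in KZ] in
  \bigcup_(L in calK) L `<=` dilate 3 K /\
  (forall alpha beta : 'rV[R]_d, KZ alpha -> KZ beta -> alpha <> beta ->
     relint (translate K (2 *: alpha)) `&` relint (translate K (2 *: beta))
       = set0).
Proof.
move=> KZ calK; split.
  move=> _ [_ [alpha [Ka _] <-] [x Kx <-]].
  exists (3^-1 *: x + (2 / 3) *: alpha).
    by apply: convex_set_comb => //; field.
  by rewrite scalerDr !scalerA divff ?pnatr_eq0// scale1r
    mulrCA divff ?pnatr_eq0// mulr1.
move=> alpha beta [_ Za] [_ Zb] neq; rewrite -subset0 => x [xa xb].
apply: neq; apply/esym/eqP; rewrite -subr_eq0; apply/eqP.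
suff : (relint K `&` int_lattice R d) (beta - alpha) by rewrite K_lattice.
split; last by move=> i; rewrite !mxE; apply: rpredB.
have rb : relint K (2 *: beta - x).
  (* Replacing [K] by its mirror image reduces the claim to [x - 2 *: beta] lying in [relint K],
     which is [xb] translated back. *)
  by rewrite K_sym -opprB; apply: relint_opp; apply: relint_translate.
have := relint_midpoint K_convex (relint_translate xa) rb.
by rewrite addrC addrA subrK -scalerBr scalerA mulVf ?pnatr_eq0// scale1r.
Qed.
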